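(* Let $\mathcal{C}$ be a preorder closed under finite limits and colimits, and let $\mathcal{W}$ be a subcategory of $\mathcal{C}$. A model structure exists on $\mathcal{C}$ with weak equivalences $\mathcal{W}$ if and only if the following two conditions hold. (a) For any two composable morphisms $f$ and $g$ in $\mathcal{C}$, if $gf$ is in $\mathcal{W}$ then $f$ and $g$ are in $\mathcal{W}$. (b) There exists a functor $\chi:\mathcal{C}\to\mathcal{C}$ such that $\chi(\mathcal{W})\subseteq \mathrm{iso}\,\mathcal{C}$ (the isomorphisms of $\mathcal{C}$), and such that for every object $A\in\mathcal{C}$ the commutative square with morphisms $A\times\chi(A)\to\chi(A)$, $A\times\chi(A)\to A$, $\chi(A)\to A\cup\chi(A)$ and $A\to A\cup\chi(A)$ lies in $\mathcal{W}$.
   Context: All categories are assumed skeletal (isomorphic objects are equal), so here $\mathcal{C}$ is a category with at most one morphism between any two objects in which isomorphic objects are equal (the objects may form a proper class). $A\cup B$ denotes the coproduct (join) and $A\times B$ the product (meet). Lifting: for morphisms $f:A\to B$ and $g:X\to Y$, $f$ lifts on the left of $g$ if every commutative square from $f$ to $g$ (with top $A\to X$ and bottom $B\to Y$) admits a morphism $h:B\to X$ making the diagram commute. For a class $S$ of morphisms, $\mathrm{RLP}(S)$ is the class of morphisms $g$ such that every $f\in S$ lifts on the left of $g$, and $\mathrm{LLP}(S)$ is the class of morphisms $f$ that lift on the left of every $g\in S$. A weak factorization system (WFS) is a pair $(\mathcal{L},\mathcal{R})$ of classes of morphisms with $\mathcal{L}=\mathrm{LLP}(\mathcal{R})$, $\mathcal{R}=\mathrm{RLP}(\mathcal{L})$,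 such that every morphism factors as a morphism in $\mathcal{L}$ followed by a morphism in $\mathcal{R}$. A model structure on a category $\mathcal{C}$ with finite limits and colimits consists of three subcategories $\mathbb{C}_{we}$ (weak equivalences), $\mathbb{C}_{cof}$ (cofibrations), $\mathbb{C}_{fib}$ (fibrations) such that $(\mathbb{C}_{cof},\mathbb{C}_{fib}\cap\mathbb{C}_{we})$ and $(\mathbb{C}_{cof}\cap\mathbb{C}_{we},\mathbb{C}_{fib})$ are WFSs, and such that whenever two of $f$, $g$, $gf$ are in $\mathbb{C}_{we}$, so is the third. *)

(* Defs.v *)
From Stdlib Require Import List FinFun.

Set Implicit Arguments.
Unset Strict Implicit.
Unset Printing Implicit Defensive.

Record category : Type := Category {
  ob :> Type;
  hom : ob -> ob -> Type;
  idm : forall a, hom a a;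
  comp : forall a b c, hom b c -> hom a b -> hom a c;
  comp_idl : forall a b (f : hom a b), comp (idm b) f = f;
  comp_idr : forall a b (f : hom a b), comp f (idm a) = f;
  comp_assoc : forall a b c d (h : hom c d) (g : hom b c) (f : hom a b),
    comp h (comp g f) = comp (comp h g) f }.

Arguments hom {C} _ _ : rename.
Arguments idm {C} _ : rename.
Arguments comp {C} [a b c] _ _ : rename.

Declare Scope cat_scope.
Delimit Scope cat_scope with cat.
Notation "g \o f" := (comp g f) (at level 50, left associativity) : cat_scope.
Local Open Scope cat_scope.

Record functor (C D : category) : Type := Functor {
  fob :> C -> D;
  fmap : forall a b : C, hom a b -> hom (fob a) (fob b);
  fmap_id : forall a : C, fmap (idm a) = idm (fob a);
  fmap_comp : forall (a b c : C) (g : hom b c) (f : hom a b),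
    fmap (g \o f) = fmap g \o fmap f }.

Arguments fmap {C D} _ [a b] _.

Definition is_iso (C : category) (a b : C) (f : hom a b) : Prop :=
  exists g : hom b a, g \o f = idm a /\ f \o g = idm b.

Definition preorder (C : category) : Prop :=
  forall (a b : C) (f g : hom a b), f = g.

Definition skeletal (C : category) : Prop :=
  forall (a b : C) (f : hom a b), is_iso f -> a = b.

Definition finite_category (J : category) : Prop :=
  Finite J /\ forall i j : J, Finite (hom i j).

Definition is_cone (J C : category) (D : functor J C) (x : C)
    (p : forall i, hom x (D i)) : Prop :=
  forall (i j : J) (u : hom i j), fmap D u \o p i = p j.

Definition is_limit (J C : category) (D : functor J C) (x : C)
    (p : forall i, hom x (D i)) : Prop :=
  is_cone p /\
  forall (y : C) (q : forall i, hom y (D i)), is_cone q ->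
    exists! h : hom y x, forall i, p i \o h = q i.

Definition is_cocone (J C : category) (D : functor J C) (x : C)
    (p : forall i, hom (D i) x) : Prop :=
  forall (i j : J) (u : hom i j), p j \o fmap D u = p i.

Definition is_colimit (J C : category) (D : functor J C) (x : C)
    (p : forall i, hom (D i) x) : Prop :=
  is_cocone p /\
  forall (y : C) (q : forall i, hom (D i) y), is_cocone q ->
    exists! h : hom x y, forall i, h \o p i = q i.

Definition has_finite_limits (C : category) : Prop :=
  forall (J : category) (D : functor J C), finite_category J ->
    exists (x : C) (p : forall i, hom x (D i)), is_limit p.

Definition has_finite_colimits (C : category) : Prop :=
  forall (J : category) (D : functor J C), finite_category J ->
    exists (x : C) (p : forall i, hom (D i) x), is_colimit p.

Definition is_product (C : category) (a b p : C)
    (p1 : hom p a) (p2 : hom p b) : Prop :=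
  forall (x : C) (u : hom x a) (v : hom x b),
    exists! h : hom x p, p1 \o h = u /\ p2 \o h = v.

Definition is_coproduct (C : category) (a b s : C)
    (i1 : hom a s) (i2 : hom b s) : Prop :=
  forall (x : C) (u : hom a x) (v : hom b x),
    exists! h : hom s x, h \o i1 = u /\ h \o i2 = v.

Definition mor_class (C : category) : Type :=
  forall a b : C, hom a b -> Prop.

Definition class_eq (C : category) (S T : mor_class C) : Prop :=
  forall (a b : C) (f : hom a b), S a b f <-> T a b f.

Definition class_cap (C : category) (S T : mor_class C) : mor_class C :=
  fun a b f => S a b f /\ T a b f.

Definition lifts_left (C : category) (a b x y : C)
    (f : hom a b) (g : hom x y) : Prop :=
  forall (u : hom a x) (v : hom b y), g \o u = v \o f ->
    exists h : hom b x, h \o f = u /\ g \o h = v.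

Definition RLP (C : category) (S : mor_class C) : mor_class C :=
  fun x y g => forall (a b : C) (f : hom a b), S a b f -> lifts_left f g.

Definition LLP (C : category) (S : mor_class C) : mor_class C :=
  fun a b f => forall (x y : C) (g : hom x y), S x y g -> lifts_left f g.

Definition WFS (C : category) (L R : mor_class C) : Prop :=
  class_eq L (LLP R) /\ class_eq R (RLP L) /\
  forall (a b : C) (f : hom a b),
    exists (c : C) (l : hom a c) (r : hom c b),
      L a c l /\ R c b r /\ r \o l = f.

(* Subcategories need not contain all objects. *)
Record subcategory (C : category) : Type := Subcategory {
  sub_ob : C -> Prop;
  sub_mor : mor_class C;
  sub_dom : forall (a b : C) (f : hom a b), sub_mor f -> sub_ob a;
  sub_cod : forall (a b : C) (f : hom a b), sub_mor f -> sub_ob b;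
  sub_idm : forall a : C, sub_ob a -> sub_mor (idm a);
  sub_comp : forall (a b c : C) (g : hom b c) (f : hom a b),
    sub_mor g -> sub_mor f -> sub_mor (g \o f) }.

Arguments sub_mor {C} _ [a b] _.

Definition two_of_three (C : category) (S : mor_class C) : Prop :=
  forall (a b c : C) (f : hom a b) (g : hom b c),
    (S a b f -> S b c g -> S a c (g \o f)) /\
    (S a b f -> S a c (g \o f) -> S b c g) /\
    (S b c g -> S a c (g \o f) -> S a b f).

Record model_structure (C : category) : Type := ModelStructure {
  weq : subcategory C;
  cof : subcategory C;
  fib : subcategory C;
  wfs_cof_acyclic_fib :
    WFS (sub_mor cof) (class_cap (sub_mor fib) (sub_mor weq));
  wfs_acyclic_cof_fib :
    WFS (class_cap (sub_mor cof) (sub_mor weq)) (sub_mor fib);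
  weq_two_of_three : two_of_three (sub_mor weq) }.

(* Main.v *)
(** In a preorder a commutative square is just a pair of inequalities, so
    everything takes place in a lattice with bottom and top.

    Given a model structure, let [chi a] be a fibrant replacement of a cofibrant
    replacement [q] of [a]: the zigzag [a <- q -> chi a] consists of weak
    equivalences, and a weak equivalence between bifibrant objects has an inverse.

    Conversely, call [a -> b] in [W] an acyclic cofibration when
    [b <= a \/ chi a]; this determines the fibrations, hence the cofibrations.
    The required factorizations of [a -> b] go through [b /\ (a \/ chi a)]
    (acyclic cofibration, fibration) and [b /\ (a \/ chi b)] (cofibration,
    acyclic fibration). *)

From Stdlib Require Import FinFun Eqdep_dec IndefiniteDescription.
Require Import Defs.
Local Open Scope cat_scope.

(** * Lifting, factorization and lattice operations for an order relation *)

Section Order.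

Context {T : Type} (le : T -> T -> Prop)
  (le_refl : forall a, le a a)
  (le_trans : forall a b c, le a b -> le b c -> le a c).

Local Infix "<=" := le.

Definition is_meet (a b m : T) : Prop :=
  m <= a /\ m <= b /\ forall x, x <= a -> x <= b -> x <= m.

Definition is_join (a b j : T) : Prop :=
  a <= j /\ b <= j /\ forall x, a <= x -> b <= x -> j <= x.

(** The triangles of a lift commute automatically in a preorder, so only the inequality remains. *)
Definition lifts (a b x y : T) : Prop := a <= x -> b <= y -> b <= x.

(** [lifts] does not itself provide an arrow between the endpoints, hence the explicit inequality in
    both lifting clauses. *)
Definition order_WFS (L R : T -> T -> Prop) : Prop :=
  (forall a b, L a b <-> a <= b /\ forall x y, R x y -> lifts a b x y) /\
  (forall x y, R x y <-> x <= y /\ forall a b, L a b -> lifts a b x y) /\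
  forall a b, a <= b -> exists c, L a c /\ R c b.

Context (meet join : T -> T -> T)
  (meetP : forall a b, is_meet a b (meet a b))
  (joinP : forall a b, is_join a b (join a b)).

Lemma meet_l a b : meet a b <= a.
Proof. apply (meetP a b). Qed.

Lemma meet_r a b : meet a b <= b.
Proof. apply (meetP a b). Qed.

Lemma meet_glb a b x : x <= a -> x <= b -> x <= meet a b.
Proof. apply (meetP a b). Qed.

Lemma join_l a b : a <= join a b.
Proof. apply (joinP a b). Qed.

Lemma join_r a b : b <= join a b.
Proof. apply (joinP a b). Qed.

Lemma join_lub a b x : a <= x -> b <= x -> join a b <= x.
Proof. apply (joinP a b). Qed.

(** Order form of condition (a). *)
Definition convex (w : T -> T -> Prop) : Prop :=
  forall a b c, a <= b -> b <= c -> w a c -> w a b /\ w b c.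

(** Order form of condition (b): invertibility of [chi a -> chi b] becomes the reverse
    inequality. *)
Definition reflector (w : T -> T -> Prop) (chi : T -> T) : Prop :=
  (forall a b, a <= b -> chi a <= chi b) /\
  (forall a b, w a b -> chi b <= chi a) /\
  (forall a m, is_meet a (chi a) m -> w m a /\ w m (chi a)) /\
  (forall a j, is_join a (chi a) j -> w a j /\ w (chi a) j).

(** * From a model structure to conditions (a) and (b) *)

Section FromModel.

Context (w c f : T -> T -> Prop)
  (w_le : forall x y, w x y -> x <= y)
  (w_comp : forall x y z, w x y -> w y z -> w x z)
  (w_cancel_r : forall x y z, y <= z -> w x y -> w x z -> w y z)
  (w_cancel_l : forall x y z, x <= y -> w y z -> w x z -> w x y)
  (wfs_c : order_WFS c (fun x y => f x y /\ w x y))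
  (wfs_f : order_WFS (fun x y => c x y /\ w x y) f).

(** Factor [a -> z] as an acyclic cofibration to [d] and a fibration, acyclic by two-of-three. Both
    projections of [meet d b] are then weak equivalences, and they connect [a -> d] with
    [a -> b]. *)
Lemma model_convex : convex w.
Proof.
  intros a b z ab bz waz.
  destruct wfs_c as (_ & fw_rlp & _), wfs_f as (cw_llp & f_rlp & fact).
  destruct (fact a z (w_le _ _ waz)) as (d & [cad wad] & fdz).
  pose proof (proj1 (proj1 (f_rlp d z) fdz)) as dz.
  pose proof (w_cancel_r _ _ _ dz wad waz) as wdz.
  pose proof (w_le _ _ wad) as ad.
  (* [meet d b -> b] is the pullback of the acyclic fibration [d -> z]. *)
  assert (fw : f (meet d b) b /\ w (meet d b) b).
  { apply fw_rlp. split; [apply meet_r|].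
    intros x y cxy xm yb. apply meet_glb; [|exact yb].
    apply (proj1 (fw_rlp d z) (conj fdz wdz)) with x.
    - exact cxy.
    - eapply le_trans; [exact xm|apply meet_l].
    - eapply le_trans; eauto. }
  assert (am : a <= meet d b) by (apply meet_glb; assumption).
  (* Since [a <= meet d b], a lifting problem for [meet d b -> d] restricts to one for [a -> d], and
     the lift [d <= x] serves both. *)
  assert (cw : c (meet d b) d /\ w (meet d b) d).
  { apply cw_llp. split; [apply meet_l|].
    intros x y fxy mx dy.
    apply (proj1 (cw_llp a d) (conj cad wad)) with y; eauto. }
  assert (wab : w a b).
  { apply w_comp with (meet d b); [|apply fw].
    apply w_cancel_l with d; tauto. }
  split; [exact wab|]. eapply w_cancel_r; eauto.
Qed.

Context (bot top : T)
  (bot_le : forall a, bot <= a) (le_top : forall a, a <= top).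

Lemma model_reflector : exists chi, reflector w chi.
Proof.
  pose proof model_convex as conv.
  destruct wfs_c as (c_llp & fw_rlp & fact1), wfs_f as (cw_llp & f_rlp & fact2).
  assert (repl : forall a, exists x, exists q,
    c bot q /\ (f q a /\ w q a) /\ (c q x /\ w q x) /\ f x top).
  { intro a. destruct (fact1 bot a (bot_le a)) as (q & cq & fq).
    destruct (fact2 q top (le_top q)) as (x & cx & fx).
    exists x, q. tauto. }
  (* Only [chi] has to be a function; the cofibrant replacement [q] stays existential. *)
  apply functional_choice in repl. destruct repl as [chi chiP].
  assert (q_le : forall q x z, c bot q -> f x z /\ w x z -> q <= z -> q <= x).
  { intros q x z cq fw qz.
    apply (proj1 (c_llp bot q) cq) with z; auto. }
  assert (le_fibrant : forall q x y, c q x /\ w q x -> f y top -> q <= y -> x <= y).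
  { intros q x y cw fy qy. apply (proj1 (f_rlp y top) fy) with q; auto. }
  exists chi. split; [|split; [|split]].
  - intros a b ab.
    destruct (chiP a) as (q & cq & [fq wq] & cwq & _).
    destruct (chiP b) as (q' & _ & fwq' & [_ wq'] & fx').
    apply le_fibrant with q; auto.
    apply le_trans with q'; auto.
    apply q_le with b; eauto.
  - intros a b wab.
    destruct (chiP a) as (q & cq & [fq wq] & cwq & fx).
    destruct (chiP b) as (q' & cq' & fwq' & cwq' & fx').
    assert (qq' : q <= q') by (apply q_le with b; eauto).
    assert (wqq' : w q q').
    { apply w_cancel_l with b; [exact qq'|tauto|eauto]. }
    assert (wqy : w q (chi b)) by (apply w_comp with q'; tauto).
    assert (xy : chi a <= chi b).
    { apply le_fibrant with q; auto. }
    assert (wxy : w (chi a) (chi b)) by (apply w_cancel_r with q; tauto).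
    (* Whitehead argument: factor [chi a -> chi b] through [z]. Cofibrancy of [chi b] gives a
       section of the acyclic fibration [z -> chi b], and fibrancy of [chi a] a retraction of the
       acyclic cofibration [chi a -> z]. *)
    destruct (fact2 _ _ xy) as (z & [cz wz] & fz).
    assert (zy : z <= chi b) by apply (proj1 (f_rlp _ _) fz).
    assert (wzy : w z (chi b)) by (apply w_cancel_r with (chi a); auto).
    apply le_trans with z.
    + destruct cwq' as [cq'y wq'y].
      apply (proj1 (c_llp _ _) cq'y) with (chi b); auto.
      apply q_le with (chi b); auto.
    + apply le_fibrant with (chi a); auto.
  - intros a m (ma & mx & glb).
    destruct (chiP a) as (q & cq & [fq wq] & [cqx wqx] & fx).
    (* Both weak equivalences [q -> a] and [q -> chi a] factor through the meet, so convexity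
       applies. *)
    assert (qm : q <= m) by (apply glb; auto).
    split.
    + apply (conv q); auto.
    + apply (conv q); auto.
  - intros a j (aj & xj & lub).
    destruct (chiP a) as (q & cq & [fq wq] & [cqx wqx] & fx).
    (* [a -> j] is the pushout of the acyclic cofibration [q -> chi a]. *)
    assert (cw : c a j /\ w a j).
    { apply cw_llp. split; [exact aj|]. intros x y fxy ax jy.
      apply lub; [exact ax|].
      apply (proj1 (cw_llp q (chi a)) (conj cqx wqx)) with y; eauto. }
    (* The other leg follows by two-of-three, [q -> a -> j] being weak. *)
    split; [apply cw|]. apply w_cancel_r with q; auto.
    apply w_comp with a; tauto.
Qed.

End FromModel.

(** * From conditions (a) and (b) to the two factorization systems *)

Section FromReflector.

Context (w : T -> T -> Prop) (chi : T -> T)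
  (w_le : forall x y, w x y -> x <= y)
  (w_convex : convex w)
  (chiP : reflector w chi).

Lemma chi_mono a b : a <= b -> chi a <= chi b.
Proof. apply chiP. Qed.

Lemma w_chi a b : w a b -> chi b <= chi a.
Proof. apply chiP. Qed.

Lemma chi_meet a : w (meet a (chi a)) a.
Proof. exact (proj1 (proj1 (proj2 (proj2 chiP)) a _ (meetP a (chi a)))). Qed.

Lemma chi_join a : w a (join a (chi a)).
Proof. exact (proj1 (proj2 (proj2 (proj2 chiP)) a _ (joinP a (chi a)))). Qed.

(** Defined before the cofibrations, since it generates the fibrations; [acyclic_cofE] shows that it
    agrees with the weak cofibrations. *)
Definition acyclic_cof (a b : T) : Prop := w a b /\ b <= join a (chi a).

Definition fibration (x y : T) : Prop :=
  x <= y /\ forall a b, acyclic_cof a b -> lifts a b x y.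

Definition cofibration (a b : T) : Prop :=
  a <= b /\ forall x y, fibration x y /\ w x y -> lifts a b x y.

(** [b] lies on the weak equivalence [a -> join a (chi a)], so convexity makes [a -> b] weak. *)
Lemma acyclic_cof_join a b : a <= b -> b <= join a (chi a) -> acyclic_cof a b.
Proof.
  intros ab bj. split; [|exact bj].
  pose proof (w_convex _ b _ ab bj (chi_join a)). tauto.
Qed.

(** With its converse below, this replaces lifting by one inequality. By monotonicity of [chi],
    [a <= x] gives [b <= join a (chi a) <= join x (chi x)]. *)
Lemma fibration_of_meet x y : x <= y ->
  meet y (join x (chi x)) <= x -> fibration x y.
Proof.
  intros xy h. split; [exact xy|]. intros a b [wab bj] ax b_y.
  apply le_trans with (2 := h). apply meet_glb; [exact b_y|].
  apply le_trans with (1 := bj). apply join_lub.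
  - apply le_trans with (1 := ax), join_l.
  - apply le_trans with (chi x); [apply chi_mono, ax|apply join_r].
Qed.

(** The arrow from [x] to the meet is an acyclic cofibration, and its lift against [x -> y] is the
    claim. *)
Lemma meet_of_fibration x y : fibration x y -> meet y (join x (chi x)) <= x.
Proof.
  intros [xy h].
  assert (xm : x <= meet y (join x (chi x))).
  { apply meet_glb; [exact xy|apply join_l]. }
  apply (h x); [|apply le_refl|apply meet_l].
  apply acyclic_cof_join; [exact xm|apply meet_r].
Qed.

(** As [a -> c] is weak, [chi c <= chi a], so [join c (chi c)] is still below [join a (chi a)] and
    the fibration criterion holds for [c]. *)
Lemma fact_acyclic_cof a b : a <= b ->
  let c := meet b (join a (chi a)) in acyclic_cof a c /\ fibration c b.
Proof.
  intros ab c.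
  assert (ac : acyclic_cof a c).
  { apply acyclic_cof_join; [|apply meet_r].
    apply meet_glb; [exact ab|apply join_l]. }
  split; [exact ac|]. apply fibration_of_meet; [apply meet_l|].
  apply meet_glb; [apply meet_l|].
  apply le_trans with (1 := meet_r _ _), join_lub; [apply meet_r|].
  apply le_trans with (chi a); [apply w_chi, ac|apply join_r].
Qed.

(** [c] lies between [meet b (chi b)] and [b], which makes [c -> b] weak by convexity. *)
Lemma fact_acyclic_fib a b : a <= b ->
  let c := meet b (join a (chi b)) in
  cofibration a c /\ (fibration c b /\ w c b).
Proof.
  intros ab c.
  assert (ac : a <= c) by (apply meet_glb; [exact ab|apply join_l]).
  assert (cb : c <= b) by apply meet_l.
  assert (wcb : w c b).
  { apply (w_convex (meet b (chi b)) c b); [|exact cb|apply chi_meet].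
    apply meet_glb; [apply meet_l|].
    apply le_trans with (1 := meet_r _ _), join_r. }
  split; [split; [exact ac|]|split; [|exact wcb]].
  - intros x y [fxy wxy] ax cy.
    apply le_trans with (2 := meet_of_fibration _ _ fxy).
    apply meet_glb; [exact cy|].
    apply le_trans with (1 := meet_r _ _), join_lub.
    + apply le_trans with (1 := ax), join_l.
    (* The chain is [chi b <= chi c <= chi y <= chi x]: the outer steps invert weak equivalences,
       the middle one is monotonicity. *)
    + apply le_trans with (chi x); [|apply join_r].
      apply le_trans with (chi c); [apply w_chi, wcb|].
      apply le_trans with (chi y); [apply chi_mono, cy|apply w_chi, wxy].
  - apply fibration_of_meet; [exact cb|].
    apply meet_glb; [apply meet_l|].
    apply le_trans with (1 := meet_r _ _), join_lub; [apply meet_r|].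
    apply le_trans with (chi b); [apply chi_mono, cb|apply join_r].
Qed.

(** Retract argument for the converse: by convexity the fibration [c -> b] of the factorization is
    weak, so the cofibration [a -> b] lifts against it and [b <= c <= join a (chi a)]. *)
Lemma acyclic_cofE a b : acyclic_cof a b <-> cofibration a b /\ w a b.
Proof.
  split.
  - intros ac. split; [split|]; try apply ac.
    + apply w_le, ac.
    + intros x y [[_ h] _]. apply h, ac.
  - intros [[ab h] wab]. destruct (fact_acyclic_cof a b ab) as [ac fb].
    split; [exact wab|].
    apply le_trans with (2 := meet_r b _).
    apply (h _ b); [|apply w_le, ac|apply le_refl].
    split; [exact fb|].
    apply (w_convex a _ b (w_le _ _ (proj1 ac)) (meet_l _ _) wab).
Qed.

Lemma WFS_cofibration : order_WFS cofibration (fun x y => fibration x y /\ w x y).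
Proof.
  split; [|split].
  - intros a b. reflexivity.
  - intros x y. split.
    + intros fw. split; [apply fw|]. intros a b [_ h]. apply h, fw.
    + intros [xy h]. destruct (fact_acyclic_fib x y xy) as [co [_ wcy]].
      (* Lifting the cofibration [x -> c] against [x -> y] gives [c <= x]. Then [x] lies between [c]
         and [y], so [x -> y] inherits weakness from [c -> y]. *)
      assert (cx : meet y (join x (chi y)) <= x).
      { apply (h x _ co); [apply le_refl|apply meet_l]. }
      assert (wxy : w x y) by exact (proj2 (w_convex _ x y cx xy wcy)).
      split; [|exact wxy]. apply fibration_of_meet; [exact xy|].
      apply le_trans with (2 := cx). apply meet_glb; [apply meet_l|].
      apply le_trans with (1 := meet_r _ _), join_lub; [apply join_l|].
      apply le_trans with (2 := join_r _ _), chi_mono, xy.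
  - intros a b ab. eexists. apply fact_acyclic_fib, ab.
Qed.

Lemma WFS_fibration : order_WFS (fun x y => cofibration x y /\ w x y) fibration.
Proof.
  split; [|split].
  - intros a b. split.
    + intros cw. split; [apply cw|]. intros x y [_ h].
      apply h, acyclic_cofE, cw.
    + intros [ab h]. apply acyclic_cofE.
      (* Again the retract argument; weakness of [a -> b] now comes out of [b <= join a (chi a)]. *)
      destruct (fact_acyclic_cof a b ab) as [ac fb].
      apply acyclic_cof_join; [exact ab|].
      apply le_trans with (2 := meet_r b _).
      apply (h _ _ fb); [apply w_le, ac|apply le_refl].
  - intros x y. split; intros [xy h]; (split; [exact xy|]);
      intros a b ac; apply h, acyclic_cofE, ac.
  - intros a b ab. eexists. rewrite <- acyclic_cofE. apply fact_acyclic_cof, ab.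
Qed.

End FromReflector.

End Order.

(** * Finite meets and joins from limits and colimits of discrete diagrams *)

Definition discrete (J : Type) : category :=
  @Category J (@eq J) (@eq_refl J) (fun a b c g f => eq_trans f g)
    (fun a b f => eq_refl)
    (fun a b f => match f with eq_refl => eq_refl end)
    (fun a b c d h g f =>
       match h with eq_refl => eq_refl end).

(** Decidable equality makes equality proofs unique, so each hom type has at most one element. *)
Lemma finite_discrete (J : Type) :
  Finite J -> (forall i j : J, {i = j} + {i <> j}) -> finite_category (discrete J).
Proof.
  intros finJ dec. split; [exact finJ|]. intros i j.
  destruct (dec i j) as [e|ne].
  - exists (cons e nil). intros e'. left. apply UIP_dec, dec.
  - exists nil. intros e'. destruct (ne e').
Qed.

Definition discrete_functor (J : Type) (C : category) (F : J -> C) :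
  functor (discrete J) C :=
  @Functor (discrete J) C F
    (fun a b e => match e in _ = b return hom (F a) (F b) with
                  | eq_refl => idm (F a) end)
    (fun a => eq_refl)
    (fun a b c g => match g with eq_refl => fun f => eq_sym (comp_idl _) end).

Definition le {C : category} (a b : C) : Prop := inhabited (hom a b).

Lemma le_refl {C : category} (a : C) : le a a.
Proof. exact (inhabits (idm a)). Qed.

Lemma le_trans {C : category} (a b c : C) : le a b -> le b c -> le a c.
Proof. intros [f] [g]. exact (inhabits (g \o f)). Qed.

(** Cones and functors need actual morphisms, which a propositional [le] yields only through
    description. *)
Definition the_hom {C : category} {a b : C} (h : le a b) : hom a b :=
  proj1_sig (constructive_indefinite_description (fun _ => True)
    (let 'inhabits f := h in ex_intro _ f I)).

Lemma finite_inf {C : category} (C_preorder : preorder C)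
    (C_lim : has_finite_limits C) (J : Type) (F : J -> C) :
  Finite J -> (forall i j : J, {i = j} + {i <> j}) ->
  exists m : C, (forall i, le m (F i)) /\
    forall x, (forall i, le x (F i)) -> le x m.
Proof.
  intros finJ dec.
  destruct (C_lim _ (discrete_functor J C F) (finite_discrete J finJ dec))
    as (m & p & _ & univ).
  exists m. split; [intros i; exact (inhabits (p i))|].
  intros x h. destruct (univ x (fun i => the_hom (h i))) as [u _].
  - intros i j e. apply C_preorder.
  - exact (inhabits u).
Qed.

Lemma finite_sup {C : category} (C_preorder : preorder C)
    (C_colim : has_finite_colimits C) (J : Type) (F : J -> C) :
  Finite J -> (forall i j : J, {i = j} + {i <> j}) ->
  exists s : C, (forall i, le (F i) s) /\
    forall x, (forall i, le (F i) x) -> le s x.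
Proof.
  intros finJ dec.
  destruct (C_colim _ (discrete_functor J C F) (finite_discrete J finJ dec))
    as (s & p & _ & univ).
  exists s. split; [intros i; exact (inhabits (p i))|].
  intros x h. destruct (univ x (fun i => the_hom (h i))) as [u _].
  - intros i j e. apply C_preorder.
  - exact (inhabits u).
Qed.

Lemma finite_bool : Finite bool.
Proof. exists (cons true (cons false nil)). intros []; simpl; auto. Qed.

Lemma finite_Empty_set : Finite Empty_set.
Proof. exists nil. intros []. Qed.

Lemma ex_meet {C : category} (C_preorder : preorder C)
    (C_lim : has_finite_limits C) :
  exists meet : C -> C -> C, forall a b, is_meet le a b (meet a b).
Proof.
  destruct (functional_choice (fun (ab : C * C) m =>
    is_meet le (fst ab) (snd ab) m)) as [meet meetP].
  - intros [a b].
    destruct (finite_inf C_preorder C_lim bool (fun i => if i then a else b)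
      finite_bool Bool.bool_dec) as (m & lb & glb).
    exists m. split; [exact (lb true)|split; [exact (lb false)|]].
    intros x xa xb. apply glb. intros []; assumption.
  - exists (fun a b => meet (a, b)). intros a b. exact (meetP (a, b)).
Qed.

Lemma ex_join {C : category} (C_preorder : preorder C)
    (C_colim : has_finite_colimits C) :
  exists join : C -> C -> C, forall a b, is_join le a b (join a b).
Proof.
  destruct (functional_choice (fun (ab : C * C) s =>
    is_join le (fst ab) (snd ab) s)) as [join joinP].
  - intros [a b].
    destruct (finite_sup C_preorder C_colim bool (fun i => if i then a else b)
      finite_bool Bool.bool_dec) as (s & ub & lub).
    exists s. split; [exact (ub true)|split; [exact (ub false)|]].
    intros x ax bx. apply lub. intros []; assumption.
  - exists (fun a b => join (a, b)). intros a b. exact (joinP (a, b)).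
Qed.

Lemma ex_top {C : category} (C_preorder : preorder C)
    (C_lim : has_finite_limits C) : exists top : C, forall a, le a top.
Proof.
  destruct (finite_inf C_preorder C_lim Empty_set (fun i => match i with end)
    finite_Empty_set) as (top & _ & h).
  - intros [].
  - exists top. intros a. apply h. intros [].
Qed.

Lemma ex_bot {C : category} (C_preorder : preorder C)
    (C_colim : has_finite_colimits C) : exists bot : C, forall a, le bot a.
Proof.
  destruct (finite_sup C_preorder C_colim Empty_set (fun i => match i with end)
    finite_Empty_set) as (bot & _ & h).
  - intros [].
  - exists bot. intros a. apply h. intros [].
Qed.

(** * Dictionary between categorical notions and the order relation *)

Section Preorder.

Context {C : category} (C_preorder : preorder C).

Lemma is_productE (a b p : C) (p1 : hom p a) (p2 : hom p b) :
  is_product p1 p2 <-> is_meet le a b p.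
Proof.
  split.
  - intros h. split; [exact (inhabits p1)|split; [exact (inhabits p2)|]].
    intros x [u] [v]. destruct (h x u v) as [k _]. exact (inhabits k).
  - intros (_ & _ & glb) x u v.
    destruct (glb x (inhabits u) (inhabits v)) as [k].
    exists k. split; [split|intros]; apply C_preorder.
Qed.

Lemma is_coproductE (a b s : C) (i1 : hom a s) (i2 : hom b s) :
  is_coproduct i1 i2 <-> is_join le a b s.
Proof.
  split.
  - intros h. split; [exact (inhabits i1)|split; [exact (inhabits i2)|]].
    intros x [u] [v]. destruct (h x u v) as [k _]. exact (inhabits k).
  - intros (_ & _ & lub) x u v.
    destruct (lub x (inhabits u) (inhabits v)) as [k].
    exists k. split; [split|intros]; apply C_preorder.
Qed.

Lemma lifts_leftE (a b x y : C) (f : hom a b) (g : hom x y) :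
  lifts_left f g <-> lifts le a b x y.
Proof.
  split.
  - intros h [u] [v]. destruct (h u v (C_preorder _ _ _ _)) as [k _].
    exact (inhabits k).
  - intros h u v _. destruct (h (inhabits u) (inhabits v)) as [k].
    exists k. split; apply C_preorder.
Qed.

Definition mor_rel (S : mor_class C) (a b : C) : Prop :=
  exists f : hom a b, S a b f.

Lemma mor_relE (S : mor_class C) (a b : C) (f : hom a b) :
  S a b f <-> mor_rel S a b.
Proof.
  split.
  - intros h. exists f. exact h.
  - intros [g h]. rewrite (C_preorder _ _ f g). exact h.
Qed.

Lemma mor_rel_le (S : mor_class C) (a b : C) : mor_rel S a b -> le a b.
Proof. intros [f _]. exact (inhabits f). Qed.

(** The relations [l] and [r] are left arbitrary so that an intersection of classes can be matched
    with a conjunction of relations. *)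
Lemma WFS_orderE (L R : mor_class C) (l r : C -> C -> Prop) :
  (forall a b (f : hom a b), L a b f <-> l a b) ->
  (forall a b (f : hom a b), R a b f <-> r a b) ->
  (forall a b, l a b -> le a b) -> (forall a b, r a b -> le a b) ->
  WFS L R <-> order_WFS le l r.
Proof.
  intros Ll Rr l_le r_le.
  assert (LLPE : forall a b (f : hom a b),
    LLP R f <-> forall x y, r x y -> lifts le a b x y).
  { intros a b f. split.
    - intros h x y rxy. destruct (r_le x y rxy) as [g].
      apply (lifts_leftE _ _ _ _ f g), h, Rr, rxy.
    - intros h x y g Rg. apply lifts_leftE, h, (Rr x y g), Rg. }
  assert (RLPE : forall x y (g : hom x y),
    RLP L g <-> forall a b, l a b -> lifts le a b x y).
  { intros x y g. split.
    - intros h a b lab. destruct (l_le a b lab) as [f].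
      apply (lifts_leftE _ _ _ _ f g), h, Ll, lab.
    - intros h a b f Lf. apply lifts_leftE, h, (Ll a b f), Lf. }
  split; intros (LR & RL & fact); (split; [|split]).
  - intros a b. split.
    + intros lab. pose proof (l_le _ _ lab) as [f].
      split; [exact (inhabits f)|]. apply (LLPE a b f), LR, Ll, lab.
    + intros [[f] h]. apply (Ll a b f), LR, LLPE, h.
  - intros x y. split.
    + intros rxy. pose proof (r_le _ _ rxy) as [g].
      split; [exact (inhabits g)|]. apply (RLPE x y g), RL, Rr, rxy.
    + intros [[g] h]. apply (Rr x y g), RL, RLPE, h.
  - intros a b [f]. destruct (fact a b f) as (c & i & p & Li & Rp & _).
    exists c. split; [apply (Ll a c i), Li|apply (Rr c b p), Rp].
  - intros a b f. rewrite Ll, LR, LLPE. pose proof (inhabits f : le a b). tauto.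
  - intros x y g. rewrite Rr, RL, RLPE. pose proof (inhabits g : le x y). tauto.
  - intros a b f. destruct (fact a b (inhabits f)) as (c & lac & rcb).
    pose proof (l_le _ _ lac) as [i]. pose proof (r_le _ _ rcb) as [p].
    exists c, i, p. split; [apply Ll, lac|split; [apply Rr, rcb|apply C_preorder]].
Qed.

Definition rel_subcategory (R : C -> C -> Prop) (R_refl : forall a, R a a)
    (R_trans : forall a b c, R a b -> R b c -> R a c) : subcategory C :=
  @Subcategory C (fun _ => True) (fun a b _ => R a b)
    (fun _ _ _ _ => I) (fun _ _ _ _ => I) (fun a _ => R_refl a)
    (fun a b c _ _ Rg Rf => R_trans a b c Rf Rg).

Lemma sub_mor_convex (W : subcategory C) :
  (forall (a b c : C) (f : hom a b) (g : hom b c),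
     sub_mor W (g \o f) -> sub_mor W f /\ sub_mor W g) <->
  convex le (mor_rel (@sub_mor C W)).
Proof.
  split.
  - intros h a b c [f] [g] wac.
    rewrite <- (mor_relE _ a b f), <- (mor_relE _ b c g).
    apply h, mor_relE, wac.
  - intros h a b c f g wgf. rewrite !mor_relE.
    apply h; [exact (inhabits f)|exact (inhabits g)|].
    eexists. exact wgf.
Qed.

Lemma sub_mor_trans (W : subcategory C) (a b c : C) :
  mor_rel (@sub_mor C W) a b -> mor_rel (@sub_mor C W) b c ->
  mor_rel (@sub_mor C W) a c.
Proof. intros [f wf] [g wg]. exists (g \o f). exact (sub_comp wg wf). Qed.

Lemma class_capE (S S' : mor_class C) (a b : C) (f : hom a b) :
  class_cap S S' f <-> mor_rel S a b /\ mor_rel S' a b.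
Proof. unfold class_cap. rewrite !mor_relE. reflexivity. Qed.

Lemma is_isoE (a b : C) (f : hom a b) : is_iso f <-> le b a.
Proof.
  split.
  - intros [g _]. exact (inhabits g).
  - intros [g]. exists g. split; apply C_preorder.
Qed.

Context (C_lim : has_finite_limits C) (C_colim : has_finite_colimits C).

(** The functor laws hold because parallel morphisms are equal. *)
Lemma reflector_functorE (W : subcategory C) :
  (exists chi : functor C C,
     (forall (a b : C) (f : hom a b), sub_mor W f -> is_iso (fmap chi f)) /\
     (forall (a p s : C) (p1 : hom p a) (p2 : hom p (chi a))
             (i1 : hom a s) (i2 : hom (chi a) s),
        is_product p1 p2 -> is_coproduct i1 i2 ->
        sub_mor W p2 /\ sub_mor W p1 /\ sub_mor W i2 /\ sub_mor W i1)) <->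
  exists chi, reflector le (mor_rel (@sub_mor C W)) chi.
Proof.
  destruct (ex_meet C_preorder C_lim) as [meet meetP].
  destruct (ex_join C_preorder C_colim) as [join joinP].
  split.
  - intros (chi & inv & sq). exists chi.
    assert (sq' : forall a m j, is_meet le a (chi a) m ->
      is_join le a (chi a) j ->
      mor_rel (@sub_mor C W) m (chi a) /\ mor_rel (@sub_mor C W) m a /\
      mor_rel (@sub_mor C W) (chi a) j /\ mor_rel (@sub_mor C W) a j).
    { intros a m j hm hj.
      pose proof hm as ([p1] & [p2] & _). pose proof hj as ([i1] & [i2] & _).
      rewrite <- (mor_relE _ _ _ p1), <- (mor_relE _ _ _ p2),
        <- (mor_relE _ _ _ i1), <- (mor_relE _ _ _ i2).
      apply sq; [apply is_productE, hm|apply is_coproductE, hj]. }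
    split; [|split; [|split]].
    + intros a b [f]. exact (inhabits (fmap chi f)).
    + intros a b [f wf]. apply (is_isoE _ _ (fmap chi f)), inv, wf.
    (* The square hypothesis wants a meet and a join together; the chosen operations supply the
       missing one here and in the next case. *)
    + intros a m hm. destruct (sq' a m _ hm (joinP a (chi a))). tauto.
    + intros a j hj. destruct (sq' a _ j (meetP a (chi a)) hj). tauto.
  - intros (chi & mono & inv & hm & hj).
    exists (@Functor C C chi (fun a b f => the_hom (mono a b (inhabits f)))
      (fun a => C_preorder _ _ _ _) (fun a b c g f => C_preorder _ _ _ _)).
    split.
    + intros a b f wf. apply is_isoE, inv, (mor_relE _ _ _ f), wf.
    + intros a p s p1 p2 i1 i2 hp hs. rewrite !mor_relE.
      destruct (hm a p) as [? ?]; [exact (proj1 (is_productE _ _ _ _ _) hp)|].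
      destruct (hj a s) as [? ?]; [exact (proj1 (is_coproductE _ _ _ _ _) hs)|].
      tauto.
Qed.

End Preorder.

(** * Transfer of both implications from the order to the category *)

Theorem theorem2 (C : category)
    (C_preorder : preorder C) (C_skeletal : skeletal C)
    (C_lim : has_finite_limits C) (C_colim : has_finite_colimits C)
    (W : subcategory C) :
  (exists M : model_structure C, weq M = W) <->
  (forall (a b c : C) (f : hom a b) (g : hom b c),
     sub_mor W (g \o f) -> sub_mor W f /\ sub_mor W g) /\
  (exists chi : functor C C,
     (forall (a b : C) (f : hom a b), sub_mor W f -> is_iso (fmap chi f)) /\
     (forall (a p s : C) (p1 : hom p a) (p2 : hom p (chi a))
             (i1 : hom a s) (i2 : hom (chi a) s),
        is_product p1 p2 -> is_coproduct i1 i2 ->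
        sub_mor W p2 /\ sub_mor W p1 /\ sub_mor W i2 /\ sub_mor W i1)).
Proof.
  rewrite (sub_mor_convex C_preorder), (reflector_functorE C_preorder C_lim C_colim).
  destruct (ex_meet C_preorder C_lim) as [meet meetP].
  destruct (ex_join C_preorder C_colim) as [join joinP].
  destruct (ex_top C_preorder C_lim) as [top le_top].
  destruct (ex_bot C_preorder C_colim) as [bot bot_le].
  set (w := mor_rel (@sub_mor C W)).
  assert (w_le : forall a b, w a b -> le a b) by apply mor_rel_le.
  assert (w_trans : forall a b c, w a b -> w b c -> w a c) by apply sub_mor_trans.
  split.
  - intros [[W' cof fib wfs_c wfs_f w23] E]. simpl in E. subst W'.
    set (c := mor_rel (@sub_mor C cof)). set (f := mor_rel (@sub_mor C fib)).
    assert (owfs_c : order_WFS le c (fun x y => f x y /\ w x y)).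
    { revert wfs_c. apply WFS_orderE; try exact C_preorder.
      - apply mor_relE, C_preorder.
      - apply class_capE, C_preorder.
      - apply mor_rel_le.
      - intros x y []. auto. }
    assert (owfs_f : order_WFS le (fun x y => c x y /\ w x y) f).
    { revert wfs_f. apply WFS_orderE; try exact C_preorder.
      - apply class_capE, C_preorder.
      - apply mor_relE, C_preorder.
      - intros x y []. auto.
      - apply mor_rel_le. }
    assert (cancel_r : forall x y z, le y z -> w x y -> w x z -> w y z).
    { intros x y z [v] [u wu] wxz. exists v.
      apply (w23 _ _ _ u v); [exact wu|].
      exact (proj2 (mor_relE C_preorder (@sub_mor C W) _ _ (v \o u)) wxz). }
    assert (cancel_l : forall x y z, le x y -> w y z -> w x z -> w x y).
    { intros x y z [u] [v wv] wxz. exists u.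
      apply (w23 _ _ _ u v); [exact wv|].
      exact (proj2 (mor_relE C_preorder (@sub_mor C W) _ _ (v \o u)) wxz). }
    split.
    + eapply model_convex; eauto using le_trans.
    + eapply model_reflector; eauto using le_refl, le_trans.
  - intros [conv [chi chiP]].
    set (fb := fibration le join w chi).
    set (cf := cofibration le join w chi).
    assert (fb_refl : forall a, fb a a).
    { intros a. split; [apply le_refl|]. intros x y _ _ h. exact h. }
    assert (fb_trans : forall a b c, fb a b -> fb b c -> fb a c).
    { intros a b c [ab h] [bc k]. split; [exact (le_trans _ _ _ ab bc)|].
      intros x y xy xa yc. apply (h x y xy xa), (k x y xy); [|exact yc].
      exact (le_trans _ _ _ xa ab). }
    assert (cf_refl : forall a, cf a a).
    { intros a. split; [apply le_refl|]. intros x y _ h _. exact h. }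
    assert (cf_trans : forall a b c, cf a b -> cf b c -> cf a c).
    { intros a b c [ab h] [bc k]. split; [exact (le_trans _ _ _ ab bc)|].
      intros x y xy ax cy. apply (k x y xy); [|exact cy].
      apply (h x y xy ax). exact (le_trans _ _ _ bc cy). }
    assert (w23 : two_of_three (@sub_mor C W)).
    { intros a b c f g. rewrite !(mor_relE C_preorder).
      (* Both cancellation clauses of two-of-three are instances of convexity. *)
      pose proof (conv a b c (inhabits f) (inhabits g)).
      split; [exact (w_trans a b c)|tauto]. }
    (* [W] itself is taken as the field [weq], so the required equality is definitional. *)
    unshelve eexists
      (@ModelStructure C W (rel_subcategory cf cf_refl cf_trans)
         (rel_subcategory fb fb_refl fb_trans) _ _ w23); [| |reflexivity].
    + apply (WFS_orderE C_preorder) with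
        (l := cf) (r := fun x y => fb x y /\ w x y).
      * reflexivity.
      * intros a b f. exact (and_iff_compat_l _ (mor_relE C_preorder _ _ _ f)).
      * intros a b cab. apply cab.
      * intros x y [_ wxy]. exact (w_le x y wxy).
      * eapply WFS_cofibration; eauto using le_refl, le_trans.
    + apply (WFS_orderE C_preorder) with
        (l := fun x y => cf x y /\ w x y) (r := fb).
      * intros a b f. exact (and_iff_compat_l _ (mor_relE C_preorder _ _ _ f)).
      * reflexivity.
      * intros x y [_ wxy]. exact (w_le x y wxy).
      * intros a b fab. apply fab.
      * eapply WFS_fibration; eauto using le_refl, le_trans.
Qed.
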